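(* Let $(B,g_B)$ and $(F_1,g_{F_1})$ be semi-Riemannian manifolds of dimensions $n$ and $s_1$, let $b_1$ be a smooth positive function on $B$, and let $\tau$ be the scalar curvature of the singly warped product $B\times_{b_1}F_1$. For a constant $\lambda\in\mathbb{R}$, $B\times_{b_1}F_1$ is Einstein with $\mathrm{Ric}=\lambda g$ if and only if the following are all verified: (a) $\mathrm{Ric}_B=\lambda g_B+\dfrac{s_1}{b_1}H_B^{b_1}$; (b) $(F_1,g_{F_1})$ is Einstein with $\mathrm{Ric}_{F_1}=\mu_1g_{F_1}$ for some constant $\mu_1$; (c) $\tau=(n+s_1)\lambda$. In other words, a singly warped product $B\times_{b_1}F_1$ of constant scalar curvature $\tau$ with Einstein fiber $F_1$ is Einstein if and only if $$\mathrm{Ric}_B=\frac{\tau}{n+s_1}g_B+\frac{s_1}{b_1}H_B^{b_1}.$$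
   Context: The singly warped product $B\times_{b_1}F_1$ is the product manifold $B\times F_1$ with metric $g=g_B\oplus b_1^2g_{F_1}$, and $\mathrm{Ric}$ is its Ricci tensor. A semi-Riemannian manifold is Einstein if its Ricci tensor is a constant multiple of its metric. $H_B^{b_1}(X,Y)=XYb_1-(\nabla^B_XY)b_1$ is the $g_B$-Hessian of $b_1$. *)

(* Defs.v *)
(* Semi-Riemannian geometry in local coordinates.  A manifold of dimension n is
   a topological space with an explicit smooth atlas; a covariant 2-tensor is
   the family of its component matrices, one matrix-valued function of the
   coordinates for each chart.  The differential operators (Levi-Civita
   connection, curvature, Hessian) act on vector fields over a chart domain,
   and the components of a tensor are its values on the coordinate frame. *)
From HB Require Import structures.
From mathcomp Require Import all_boot all_order all_algebra.
From mathcomp Require Import all_classical all_reals all_analysis.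

Set Implicit Arguments.
Unset Strict Implicit.
Unset Printing Implicit Defensive.

Import Order.TTheory GRing.Theory Num.Theory.
Import numFieldNormedType.Exports.

Local Open Scope classical_set_scope.
Local Open Scope ring_scope.

Section Smooth.
Variables (R : realType) (n : nat).
Implicit Types (f : 'rV[R]_n -> R) (U : set 'rV[R]_n).

Definition partial (i : 'I_n) f : 'rV[R]_n -> R :=
  fun x => 'D_(delta_mx 0 i) f x.

Fixpoint iter_partial (l : seq 'I_n) f : 'rV[R]_n -> R :=
  if l is i :: l' then partial i (iter_partial l' f) else f.

(* C^oo on the open set U: all the iterated partial derivatives exist and are
   continuous at every point of U. *)
Definition smooth_on U f : Prop :=
  forall (l : seq 'I_n) (x : 'rV[R]_n), U x ->
    {for x, continuous (iter_partial l f)} /\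
    (forall i, derivable (iter_partial l f) x (delta_mx 0 i)).

End Smooth.

Section Manifolds.
Variables (R : realType) (n : nat).

(* [chart_inv i] is only meaningful on the range of the chart i, and [chart i]
   on its domain; the axioms are in [smooth_manifold]. *)
Record atlas (M : topologicalType) := Atlas {
  chart_index : Type;
  chart_dom : chart_index -> set M;
  chart : chart_index -> M -> 'rV[R]_n;
  chart_inv : chart_index -> 'rV[R]_n -> M
}.

Definition chart_ran (M : topologicalType) (A : atlas M) (i : chart_index A) :
  set 'rV[R]_n := chart i @` chart_dom i.

Definition transition (M : topologicalType) (A : atlas M)
  (i j : chart_index A) : 'rV[R]_n -> 'rV[R]_n := chart j \o chart_inv i.

Definition overlap (M : topologicalType) (A : atlas M) (i j : chart_index A) :
  set 'rV[R]_n := chart i @` (chart_dom i `&` chart_dom j).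

(* Manifolds are not assumed to be connected, but they are nonempty. *)
Definition smooth_manifold (M : topologicalType) (A : atlas M) : Prop :=
  [/\ [/\ hausdorff_space M, @second_countable M & [set: M] !=set0],
      forall p : M, exists i : chart_index A, chart_dom i p,
      forall i : chart_index A,
        [/\ open (chart_dom i), open (chart_ran i),
            {in chart_dom i, cancel (chart i) (chart_inv i)},
            {within chart_dom i, continuous (chart i)} &
            {within chart_ran i, continuous (chart_inv i)}] &
      forall (i j : chart_index A) (k : 'I_n),
        smooth_on (overlap i j) (fun x => transition i j x 0 k)].

Definition smooth_function (M : topologicalType) (A : atlas M) (f : M -> R) :
  Prop :=
  forall i : chart_index A, smooth_on (chart_ran i) (f \o chart_inv i).

Definition tensor2 (M : topologicalType) (A : atlas M) : Type :=
  chart_index A -> 'rV[R]_n -> 'M[R]_n.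

Definition tensor_eq (M : topologicalType) (A : atlas M) (S T : tensor2 A) :
  Prop :=
  forall (i : chart_index A) (x : 'rV[R]_n), chart_ran i x -> S i x = T i x.

(* [negative_on G W]: the symmetric bilinear form with matrix G is negative
   definite on the row space of W. *)
Definition negative_on (G W : 'M[R]_n) : Prop :=
  forall u : 'rV[R]_n, (u <= W)%MS -> u != 0 -> (u *m G *m u^T) 0 0 < 0.

Definition has_index (G : 'M[R]_n) (nu : nat) : Prop :=
  (exists2 W : 'M[R]_n, negative_on G W & \rank W = nu) /\
  (forall W : 'M[R]_n, negative_on G W -> (\rank W <= nu)%N).

(* Vectors are rows, so that 'J phi x maps the coordinates u of a tangent
   vector to u *m 'J phi x; this fixes the side of the transpose in the change
   of coordinates rule. *)
Definition semi_riemannian_metric (M : topologicalType) (A : atlas M)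
    (g : tensor2 A) : Prop :=
  [/\ forall (i : chart_index A) (a c : 'I_n),
        smooth_on (chart_ran i) (fun x => g i x a c),
      forall (i j : chart_index A) (x : 'rV[R]_n), overlap i j x ->
        g i x = 'J (transition i j) x *m g j (transition i j x)
                  *m ('J (transition i j) x)^T,
      forall (i : chart_index A) (x : 'rV[R]_n), chart_ran i x ->
        (g i x)^T = g i x /\ g i x \in unitmx &
      exists nu : nat, forall (i : chart_index A) (x : 'rV[R]_n),
        chart_ran i x -> has_index (g i x) nu].

Definition semi_riemannian_manifold (M : topologicalType) (A : atlas M)
    (g : tensor2 A) : Prop :=
  smooth_manifold A /\ semi_riemannian_metric g.

End Manifolds.

Section LocalGeometry.
Variables (R : realType) (n : nat).
Local Notation vector_field := ('rV[R]_n -> 'rV[R]_n).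
Implicit Types (g : 'rV[R]_n -> 'M[R]_n) (X Y Z : vector_field).
Implicit Types (f : 'rV[R]_n -> R) (x : 'rV[R]_n).

Definition frame (i : 'I_n) : vector_field := fun=> delta_mx 0 i.

Definition vderive X f : 'rV[R]_n -> R :=
  fun x => \sum_(i < n) X x 0 i * partial i f x.

Definition lie_bracket X Y : vector_field := fun x =>
  \row_k (vderive X (fun y => Y y 0 k) x - vderive Y (fun y => X y 0 k) x).

(* Gamma^k_ij *)
Definition christoffel g (k i j : 'I_n) : 'rV[R]_n -> R := fun x =>
  2^-1 * \sum_(l < n) invmx (g x) k l *
    (partial i (fun y => g y j l) x + partial j (fun y => g y i l) x
     - partial l (fun y => g y i j) x).

(* The Levi-Civita connection: nabla g X Y is nabla_X Y. *)
Definition nabla g X Y : vector_field := fun x =>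
  \row_k (vderive X (fun y => Y y 0 k) x +
          \sum_(i < n) \sum_(j < n) christoffel g k i j x * X x 0 i * Y x 0 j).

Definition hessian_vf g f X Y : 'rV[R]_n -> R := fun x =>
  vderive X (vderive Y f) x - vderive (nabla g X Y) f x.

Definition riemann g X Y Z : vector_field := fun x =>
  nabla g X (nabla g Y Z) x - nabla g Y (nabla g X Z) x
  - nabla g (lie_bracket X Y) Z x.

(* Ric(Y, Z) is the trace of X |-> R(X, Y) Z (positive on round spheres). *)
Definition ricci_vf g Y Z : 'rV[R]_n -> R := fun x =>
  \sum_(k < n) riemann g (frame k) Y Z x 0 k.

End LocalGeometry.

Section Curvature.
Variables (R : realType) (n : nat) (M : topologicalType) (A : atlas R n M).

Definition hessian (g : tensor2 A) (f : M -> R) : tensor2 A := fun i x =>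
  \matrix_(a, c) hessian_vf (g i) (f \o chart_inv i) (frame a) (frame c) x.

Definition ricci (g : tensor2 A) : tensor2 A := fun i x =>
  \matrix_(a, c) ricci_vf (g i) (frame a) (frame c) x.

Definition scalar_curvature (g : tensor2 A) :
  chart_index A -> 'rV[R]_n -> R := fun i x =>
  \sum_(a < n) \sum_(c < n) invmx (g i x) a c * ricci g i x a c.

Definition has_scalar_curvature (g : tensor2 A) (tau : R) : Prop :=
  forall (i : chart_index A) (x : 'rV[R]_n), chart_ran i x ->
    scalar_curvature g i x = tau.

Definition einstein_with (g : tensor2 A) (lambda : R) : Prop :=
  tensor_eq (ricci g) (fun i x => lambda *: g i x).

Definition einstein (g : tensor2 A) : Prop :=
  exists lambda : R, einstein_with g lambda.

End Curvature.

Section WarpedProduct.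
Variables (R : realType) (n s : nat) (B F : topologicalType).

Definition prod_atlas (AB : atlas R n B) (AF : atlas R s F) :
  atlas R (n + s) (B * F)%type :=
  @Atlas R (n + s) (B * F)%type
    (chart_index AB * chart_index AF)%type
    (fun ij => chart_dom ij.1 `*` chart_dom ij.2)
    (fun ij p => row_mx (chart ij.1 p.1) (chart ij.2 p.2))
    (fun ij x => (chart_inv ij.1 (lsubmx x), chart_inv ij.2 (rsubmx x))).

Definition warped_metric (AB : atlas R n B) (AF : atlas R s F)
    (gB : tensor2 AB) (gF : tensor2 AF) (b : B -> R) :
  tensor2 (prod_atlas AB AF) := fun ij x =>
  block_mx (gB ij.1 (lsubmx x)) 0
           0 ((b (chart_inv ij.1 (lsubmx x))) ^+ 2 *: gF ij.2 (rsubmx x)).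

End WarpedProduct.

(* Main.v *)
Require Import Defs.
From HB Require Import structures.
From mathcomp Require Import all_boot all_order all_algebra.
From mathcomp Require Import all_classical all_reals all_analysis.
From mathcomp Require Import ring.

(** In a product chart, write [g] and [h] for the component matrices of the base
    and of the fiber, [f] for the warping function, and let latin indices refer
    to the base and greek ones to the fiber.  The Christoffel symbols of
    [g + f^2 h] are those of [g] and of [h], together with

      Gamma^k_(alpha beta) = - f (grad f)^k h_(alpha beta)   and
      Gamma^alpha_(i beta) = Gamma^alpha_(beta i)
                           = delta^alpha_beta (d_i f) / f,

    the other mixed symbols being zero ([christoffel_warpedL] and its
    companions).  Substituting them in the coordinate formula for the Ricci
    tensor [ricci_frame] gives a block diagonal tensor ([ricci_warped]):

      Ric_B - (s / f) Hess f   on the base,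
      Ric_F - phi h            on the fiber,

    where the function [phi = f (Laplacian f) + (s - 1) |grad f|^2] depends on
    the base point alone ([fiber_defect]).  Hence [Ric = lambda (g + f^2 h)]
    means the base equation together with [Ric_F = (lambda f^2 + phi) h] at
    every pair of points ([einstein_warpedP]).

    If the latter holds, freezing one base point shows that the fiber is
    Einstein, and the scalar curvature is the trace of [lambda] times the
    metric.  Conversely, if the base equation holds and [Ric_F = mu h], then the
    scalar curvature is [n lambda + s (mu - phi) / f^2]; that it equals
    [(n + s) lambda] forces [mu = lambda f^2 + phi] as soon as [s] is positive,
    and there is no fiber equation when [s = 0]
    ([einstein_warped_scalarP]).  So the scalar curvature supplies the value of
    [phi] at each point.  The second form of the theorem follows, as
    [tau] determines [lambda] unless [n + s = 0], in which case every equation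
    between tensors is void ([einstein_scalar_constP]). *)

Set Implicit Arguments.
Unset Strict Implicit.
Unset Printing Implicit Defensive.

Import Order.TTheory GRing.Theory Num.Theory.
Import numFieldNormedType.Exports.

Local Open Scope classical_set_scope.
Local Open Scope ring_scope.

(** * Partial derivatives and derivability *)

Section Partial.
Variables (R : realType) (n : nat).
Implicit Types (f g : 'rV[R]_n -> R) (U : set 'rV[R]_n) (x v : 'rV[R]_n).

Lemma derivable_const (c : R) x v : derivable (fun=> c) x v.
Proof. exact: derivable_cst. Qed.

Lemma partial_cst (c : R) (a : 'I_n) x : partial a (fun=> c) x = 0.
Proof. exact: derive_cst. Qed.

Lemma derivable_mul f g x v : derivable f x v -> derivable g x v ->
  derivable (fun y => f y * g y) x v.
Proof. by move=> df dg; exact: (@derivableM _ _ f g x v df dg). Qed.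

Lemma derivable_inv f x v : f x != 0 -> derivable f x v ->
  derivable (fun y => (f y)^-1) x v.
Proof. exact: derivableV. Qed.

Lemma partialM f g (a : 'I_n) x :
  derivable f x (delta_mx 0 a) -> derivable g x (delta_mx 0 a) ->
  partial a (fun y => f y * g y) x = f x * partial a g x + g x * partial a f x.
Proof. by move=> df dg; exact: (@deriveM _ _ f g x _ df dg). Qed.

Lemma partialMr f (c : R) (a : 'I_n) x : derivable f x (delta_mx 0 a) ->
  partial a (fun y => f y * c) x = partial a f x * c.
Proof.
move=> df; rewrite (@partialM f (fun=> c) a x df (@derivable_const c x _)).
by rewrite partial_cst mulr0 add0r mulrC.
Qed.

Lemma partialMl f (c : R) (a : 'I_n) x : derivable f x (delta_mx 0 a) ->
  partial a (fun y => c * f y) x = c * partial a f x.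
Proof.
move=> df; rewrite (@partialM (fun=> c) f a x (@derivable_const c x _) df).
by rewrite partial_cst mulr0 addr0.
Qed.

Lemma partial_div f g (a : 'I_n) x : g x != 0 ->
  derivable f x (delta_mx 0 a) -> derivable g x (delta_mx 0 a) ->
  partial a (fun y => f y / g y) x =
  partial a f x / g x - f x * partial a g x / g x ^+ 2.
Proof.
move=> g0 df dg.
rewrite (@partialM f (fun y => (g y)^-1) a x df (derivable_inv g0 dg)).
rewrite {1}/partial (deriveV g0 dg) -/(partial a g x) /GRing.scale /=.
by field.
Qed.

Lemma partial_eq_on U f g (a : 'I_n) x : open U -> U x ->
  (forall y, U y -> f y = g y) -> partial a f x = partial a g x.
Proof.
move=> oU Ux fg; apply: near_eq_derive.
by apply: filterS fg _; apply: open_nbhs_nbhs.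
Qed.

Lemma derivable_eq_on U f g x v : open U -> U x ->
  (forall y, U y -> f y = g y) -> derivable f x v -> derivable g x v.
Proof.
move=> oU Ux fg; apply: near_eq_derivable.
by apply: filterS fg _; apply: open_nbhs_nbhs.
Qed.

Lemma derivable_bigsum (I : Type) (r : seq I) (F : I -> 'rV[R]_n -> R) x v :
  (forall i, derivable (F i) x v) ->
  derivable (fun y => \sum_(i <- r) F i y) x v.
Proof.
move=> dF; elim: r => [|i r IH].
  by under [fun y => _]funext do rewrite big_nil; exact: derivable_const.
by under [fun y => _]funext do rewrite big_cons;
  exact: (@derivableD _ _ _ (F i) _ x v (dF i) IH).
Qed.

Lemma derivable_bigprod (I : Type) (r : seq I) (F : I -> 'rV[R]_n -> R) x v :
  (forall i, derivable (F i) x v) ->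
  derivable (fun y => \prod_(i <- r) F i y) x v.
Proof.
move=> dF; elim: r => [|i r IH].
  by under [fun y => _]funext do rewrite big_nil; exact: derivable_const.
by under [fun y => _]funext do rewrite big_cons;
  exact: (@derivable_mul (F i) _ x v (dF i) IH).
Qed.

Lemma derivable_det m (A : 'rV[R]_n -> 'M[R]_m) x v :
  (forall i j, derivable (fun y => A y i j) x v) ->
  derivable (fun y => \det (A y)) x v.
Proof.
move=> dA; apply: derivable_bigsum => s.
apply: (@derivable_mul (fun=> _)); first exact: derivable_const.
exact: derivable_bigprod.
Qed.

(** Cramer's rule: the entries of the inverse are cofactors divided by the
    determinant, as long as the matrix stays invertible around the point. *)
Lemma derivable_invmx m U (A : 'rV[R]_n -> 'M[R]_m) x v : open U -> U x ->
  (forall y, U y -> A y \in unitmx) ->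
  (forall i j, derivable (fun y => A y i j) x v) ->
  forall i j, derivable (fun y => invmx (A y) i j) x v.
Proof.
move=> oU Ux Au dA i j.
apply: (@derivable_eq_on U
  (fun y => (\det (A y))^-1 * cofactor (A y) j i)) => //.
  by move=> y /Au Ay; rewrite /invmx Ay !mxE.
apply: derivable_mul; first apply: derivable_inv.
- by rewrite -unitfE; apply: Au.
- exact: derivable_det.
apply: (@derivable_mul (fun=> _)); first exact: derivable_const.
apply: derivable_det => k l.
by under [fun y => _]funext do rewrite !mxE; apply: dA.
Qed.

Lemma smooth_derivable U f x (a : 'I_n) : smooth_on U f -> U x ->
  derivable f x (delta_mx 0 a).
Proof. by move=> sf Ux; have [_ df] := sf [::] x Ux; exact: df. Qed.

Lemma smooth_partial_derivable U f x (a c : 'I_n) : smooth_on U f -> U x ->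
  derivable (partial a f) x (delta_mx 0 c).
Proof. by move=> sf Ux; have [_ df] := sf [:: a] x Ux; exact: df. Qed.

End Partial.

(** * Partial derivatives on a product *)

Section ProductPartial.
Variables (R : realType) (n s : nat).
Implicit Types (F : 'rV[R]_(n + s) -> R).

(** Both sides are limits of the same difference quotients.  This reduces every
    derivative below to one factor, where it can be computed from the values on
    an open set of that factor. *)
Lemma partial_lshift F (a : 'I_n) y z :
  partial (lshift s a) F (row_mx y z) =
  partial a (fun y' => F (row_mx y' z)) y.
Proof.
rewrite /partial /derive; do 2 f_equal; apply/funext => t /=.
by rewrite delta_mx_lshift scale_row_mx add_row_mx scaler0 add0r.
Qed.

Lemma partial_rshift F (a : 'I_s) y z :
  partial (rshift n a) F (row_mx y z) =
  partial a (fun z' => F (row_mx y z')) z.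
Proof.
rewrite /partial /derive; do 2 f_equal; apply/funext => t /=.
by rewrite delta_mx_rshift scale_row_mx add_row_mx scaler0 add0r.
Qed.

End ProductPartial.

(** * Components in the coordinate frame *)

Section FrameComponents.
Variables (R : realType) (n : nat).
Implicit Types (g : 'rV[R]_n -> 'M[R]_n) (f : 'rV[R]_n -> R).

Lemma vderive_frame (a : 'I_n) f : vderive (frame a) f = partial a f.
Proof.
apply/funext => x; rewrite /vderive (bigD1 a) //= big1 => [|i ia].
  by rewrite /frame mxE !eqxx mul1r addr0.
by rewrite /frame mxE eqxx (negbTE ia) mul0r.
Qed.

Lemma nabla_frame_l g (a : 'I_n) Y x (k : 'I_n) :
  nabla g (frame a) Y x 0 k =
  partial a (fun y => Y y 0 k) x + \sum_j christoffel g k a j x * Y x 0 j.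
Proof.
rewrite /nabla mxE vderive_frame; congr (_ + _).
rewrite (bigD1 a) //= [X in _ + X]big1 => [|i ia].
  by rewrite addr0; apply: eq_bigr => j _; rewrite /frame mxE !eqxx mulr1.
by apply: big1 => j _; rewrite /frame mxE eqxx (negbTE ia) mulr0 mul0r.
Qed.

Lemma nabla_frame g (a c : 'I_n) x (k : 'I_n) :
  nabla g (frame a) (frame c) x 0 k = christoffel g k a c x.
Proof.
rewrite nabla_frame_l [partial _ _ _]partial_cst add0r (bigD1 c) //=.
rewrite big1 => [|i ic]; first by rewrite /frame mxE !eqxx mulr1 addr0.
by rewrite /frame mxE eqxx (negbTE ic) mulr0.
Qed.

Lemma nabla0 g Y x : nabla g (fun=> 0) Y x = 0.
Proof.
apply/rowP => k; rewrite !mxE /vderive big1 => [|i _]; last first.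
  by rewrite mxE mul0r.
rewrite add0r big1 // => i _; rewrite big1 // => j _.
by rewrite mxE mulr0 mul0r.
Qed.

Lemma lie_bracket_frame (a c : 'I_n) :
  lie_bracket (frame a) (frame c) = (fun=> 0 : 'rV[R]_n).
Proof.
apply/funext => x; apply/rowP => k.
rewrite !mxE !vderive_frame.
rewrite [partial a _ _](partial_cst (delta_mx 0 c 0 k)).
by rewrite [partial c _ _](partial_cst (delta_mx 0 a 0 k)) subrr mxE.
Qed.

(** Coordinate fields commute, so only the first two terms of the curvature
    contribute. *)
Lemma ricci_frame g (a c : 'I_n) x :
  ricci_vf g (frame a) (frame c) x =
  \sum_k (partial k (christoffel g k a c) x
          + \sum_j christoffel g k k j x * christoffel g j a c x
          - (partial a (christoffel g k k c) x
             + \sum_j christoffel g k a j x * christoffel g j k c x)).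
Proof.
rewrite /ricci_vf; apply: eq_bigr => k _.
rewrite /riemann lie_bracket_frame nabla0 subr0 mxE [X in _ + X]mxE.
rewrite !nabla_frame_l.
have nablaE i j l :
    (fun y => nabla g (frame i) (frame j) y 0 l) = christoffel g l i j.
  by apply/funext => y; rewrite nabla_frame.
rewrite !nablaE.
by congr (_ + _ - (_ + _)); apply: eq_bigr => j _; rewrite nabla_frame.
Qed.

Lemma hessian_frame g f (a c : 'I_n) x :
  hessian_vf g f (frame a) (frame c) x =
  partial a (partial c f) x - \sum_j christoffel g j a c x * partial j f x.
Proof.
rewrite /hessian_vf !vderive_frame; congr (_ - _).
by apply: eq_bigr => j _; rewrite nabla_frame.
Qed.

Lemma christoffel_sym U g (k i j : 'I_n) x : open U -> U x ->
  (forall y, U y -> (g y)^T = g y) ->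
  christoffel g k i j x = christoffel g k j i x.
Proof.
move=> oU Ux gsym; congr (_ * _); apply: eq_bigr => l _; congr (_ * _).
rewrite [partial i _ _ + _]addrC; congr (_ - _).
by apply: (partial_eq_on l oU Ux) => y /gsym gy; rewrite -[in LHS]gy mxE.
Qed.

End FrameComponents.

(** * Christoffel symbols of a warped product *)

Lemma invmx_sum (R : fieldType) m (A : 'M[R]_m) (c d : 'I_m) :
  A^T = A -> A \in unitmx -> \sum_l invmx A c l * A d l = (c == d)%:R.
Proof.
move=> At Au; have /matrixP/(_ c d) := mulVmx Au; rewrite !mxE => <-.
apply: eq_bigr => l _; congr (_ * _).
by rewrite -[in LHS]At mxE.
Qed.

Lemma sum_ord_const (R : pzRingType) m (r : R) : \sum_(k < m) r = m%:R * r.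
Proof. by rewrite sumr_const card_ord mulr_natl. Qed.

Lemma sum_delta (R : pzRingType) m (k : 'I_m) (G : 'I_m -> R) :
  \sum_j (k == j)%:R * G j = G k.
Proof.
rewrite (bigD1 k) //= eqxx mul1r big1 ?addr0 // => j jk.
by rewrite eq_sym (negbTE jk) mul0r.
Qed.

(** What the local computation needs of a metric in one chart. *)
Definition chart_metric (R : realType) n (U : set 'rV[R]_n)
    (g : 'rV[R]_n -> 'M[R]_n) : Prop :=
  [/\ open U, forall a c, smooth_on U (fun x => g x a c),
      forall x, U x -> (g x)^T = g x & forall x, U x -> g x \in unitmx].

Section WarpedChart.
Variables (R : realType) (n s : nat).
Variables (U : set 'rV[R]_n) (V : set 'rV[R]_s).
Variables (g : 'rV[R]_n -> 'M[R]_n) (h : 'rV[R]_s -> 'M[R]_s).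
Variable f : 'rV[R]_n -> R.
Hypotheses (hg : chart_metric U g) (hh : chart_metric V h).
Hypothesis f_smooth : smooth_on U f.
Hypothesis f_neq0 : forall y, U y -> f y != 0.

Let oU : open U. Proof. by case: hg. Qed.
Let oV : open V. Proof. by case: hh. Qed.
Let g_smooth a c : smooth_on U (fun y => g y a c).
Proof. by case: hg => _ /(_ a c). Qed.
Let h_smooth a c : smooth_on V (fun z => h z a c).
Proof. by case: hh => _ /(_ a c). Qed.
Let g_sym y : U y -> (g y)^T = g y. Proof. by case: hg => _ _ H _ /H. Qed.
Let h_sym z : V z -> (h z)^T = h z. Proof. by case: hh => _ _ H _ /H. Qed.
Let g_unit y : U y -> g y \in unitmx. Proof. by case: hg => _ _ _ H /H. Qed.
Let h_unit z : V z -> h z \in unitmx. Proof. by case: hh => _ _ _ H /H. Qed.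

Local Notation L := (lshift s).
Local Notation F := (rshift n).

Definition warped (x : 'rV[R]_(n + s)) : 'M[R]_(n + s) :=
  block_mx (g (lsubmx x)) 0 0 (f (lsubmx x) ^+ 2 *: h (rsubmx x)).

Definition grad (k : 'I_n) (y : 'rV[R]_n) : R :=
  \sum_l invmx (g y) k l * partial l f y.

(** This is [f (Laplacian f) + (s - 1) |grad f|^2], written as
    [div (f grad f) + (s - 2) |grad f|^2], the form in which it appears in the
    contraction of the Christoffel symbols. *)
Definition fiber_defect (y : 'rV[R]_n) : R :=
  \sum_k (partial k (fun y => f y * grad k y) y
          + \sum_j christoffel g k k j y * (f y * grad j y))
  + (s%:R - 2) * \sum_k grad k y * partial k f y.

Lemma warpedE y z :
  warped (row_mx y z) = block_mx (g y) 0 0 (f y ^+ 2 *: h z).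
Proof. by rewrite /warped row_mxKl row_mxKr. Qed.

Lemma warped_sym y z : U y -> V z ->
  (warped (row_mx y z))^T = warped (row_mx y z).
Proof.
move=> Uy Vz.
by rewrite warpedE tr_block_mx !trmx0 linearZ /= g_sym // h_sym.
Qed.

Lemma warped_unit y z : U y -> V z -> warped (row_mx y z) \in unitmx.
Proof.
move=> Uy Vz; rewrite warpedE unitmxE det_ublock detZ !unitrM -!unitmxE.
by rewrite g_unit // h_unit //= andbT !unitrX // unitfE f_neq0.
Qed.

Lemma invmx_warped y z : U y -> V z ->
  invmx (warped (row_mx y z)) =
  block_mx (invmx (g y)) 0 0 ((f y ^+ 2)^-1 *: invmx (h z)).
Proof.
move=> Uy Vz; have := warped_unit Uy Vz; rewrite warpedE => Wu.
rewrite invmx_block_diag // invmxZ //.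
by rewrite unitmxZ ?h_unit // unitfE expf_neq0 // f_neq0.
Qed.

Section AtPoint.
Variables (y : 'rV[R]_n) (z : 'rV[R]_s).
Hypotheses (Uy : U y) (Vz : V z).
Local Notation yz := (row_mx y z).

Lemma partial_warpedLL a c :
  (forall i, partial (L i) (fun x => warped x (L a) (L c)) yz =
     partial i (fun y => g y a c) y)
  * (forall i, partial (F i) (fun x => warped x (L a) (L c)) yz = 0).
Proof.
split=> i; rewrite ?partial_lshift ?partial_rshift.
  by under [fun y' => _]funext do rewrite warpedE block_mxEul.
under [fun z' => _]funext do rewrite warpedE block_mxEul.
exact: partial_cst.
Qed.

Lemma partial_warpedLF K a c :
  (partial K (fun x => warped x (L a) (F c)) yz = 0)
  * (partial K (fun x => warped x (F c) (L a)) yz = 0).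
Proof.
split.
  under [fun x => _]funext do rewrite /warped block_mxEur mxE.
  exact: partial_cst.
under [fun x => _]funext do rewrite /warped block_mxEdl mxE.
exact: partial_cst.
Qed.

Lemma partial_warpedFF a c :
  (forall i, partial (L i) (fun x => warped x (F a) (F c)) yz =
     2 * f y * partial i f y * h z a c)
  * (forall i, partial (F i) (fun x => warped x (F a) (F c)) yz =
     f y ^+ 2 * partial i (fun z => h z a c) z).
Proof.
split=> i; rewrite ?partial_lshift ?partial_rshift.
  under [fun y' => _]funext do rewrite warpedE block_mxEdr mxE expr2.
  have df : derivable f y (delta_mx 0 i) by exact: smooth_derivable Uy.
  rewrite (@partialMr _ _ (fun y' => f y' * f y')); last exact: derivable_mul.
  by rewrite partialM //; ring.
under [fun z' => _]funext do rewrite warpedE block_mxEdr mxE.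
by rewrite partialMl //; exact: smooth_derivable Vz.
Qed.

Let pW := (partial_warpedLL, partial_warpedLF, partial_warpedFF).

Let invW := (invmx_warped Uy Vz, block_mxEul, block_mxEur, block_mxEdl,
  block_mxEdr).

(** In the names of these eight lemmas, [L] stands for a base index and [F] for
    a fiber index, the upper index coming first; a single letter means that the
    three indices are of that kind. *)
Lemma christoffel_warpedL (k i j : 'I_n) :
  christoffel warped (L k) (L i) (L j) yz = christoffel g k i j y.
Proof.
rewrite /christoffel big_split_ord /= [X in _ + X]big1 => [|l _].
  rewrite addr0; congr (_ * _); apply: eq_bigr => l _.
  by rewrite !invW !pW.
by rewrite !invW mxE mul0r.
Qed.

Lemma christoffel_warpedFLL (k : 'I_s) (i j : 'I_n) :
  christoffel warped (F k) (L i) (L j) yz = 0.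
Proof.
rewrite /christoffel big_split_ord /= !big1 ?addr0 ?mulr0 // => l _.
  by rewrite !invW !pW subr0 addr0 mulr0.
by rewrite !invW mxE mul0r.
Qed.

Lemma christoffel_warpedLLF (k i : 'I_n) (j : 'I_s) :
  christoffel warped (L k) (L i) (F j) yz = 0.
Proof.
rewrite /christoffel big_split_ord /= !big1 ?addr0 ?mulr0 // => l _.
  by rewrite !invW mxE mul0r.
by rewrite !invW !pW subr0 addr0 mulr0.
Qed.

Lemma christoffel_warpedLFL (k i : 'I_n) (j : 'I_s) :
  christoffel warped (L k) (F j) (L i) yz = 0.
Proof.
rewrite /christoffel big_split_ord /= !big1 ?addr0 ?mulr0 // => l _.
  by rewrite !invW mxE mul0r.
by rewrite !invW !pW subr0 addr0 mulr0.
Qed.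

Lemma christoffel_warpedFLF (k j : 'I_s) (i : 'I_n) :
  christoffel warped (F k) (L i) (F j) yz =
  (k == j)%:R * (partial i f y / f y).
Proof.
have f0 := f_neq0 Uy.
rewrite /christoffel big_split_ord /= big1 => [|l _].
  rewrite add0r -(@invmx_sum _ _ (h z)) ?h_sym ?h_unit // mulr_suml mulr_sumr.
  by apply: eq_bigr => l _; rewrite !invW !pW mxE; field.
by rewrite !invW mxE mul0r.
Qed.

Lemma christoffel_warpedFFL (k j : 'I_s) (i : 'I_n) :
  christoffel warped (F k) (F j) (L i) yz =
  (k == j)%:R * (partial i f y / f y).
Proof.
have f0 := f_neq0 Uy.
rewrite /christoffel big_split_ord /= big1 => [|l _].
  rewrite add0r -(@invmx_sum _ _ (h z)) ?h_sym ?h_unit // mulr_suml mulr_sumr.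
  by apply: eq_bigr => l _; rewrite !invW !pW mxE; field.
by rewrite !invW mxE mul0r.
Qed.

Lemma christoffel_warpedLFF (k : 'I_n) (i j : 'I_s) :
  christoffel warped (L k) (F i) (F j) yz = - (f y * grad k y) * h z i j.
Proof.
rewrite /christoffel big_split_ord /= [X in _ + X]big1 => [|l _].
  rewrite addr0 /grad !mulr_sumr -sumrN mulr_suml.
  by apply: eq_bigr => l _; rewrite !invW !pW; field.
by rewrite !invW mxE mul0r.
Qed.

Lemma christoffel_warpedF (k i j : 'I_s) :
  christoffel warped (F k) (F i) (F j) yz = christoffel h k i j z.
Proof.
have f0 := f_neq0 Uy.
rewrite /christoffel big_split_ord /= big1 => [|l _].
  rewrite add0r; congr (_ * _); apply: eq_bigr => l _.
  by rewrite !invW !pW mxE; field.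
by rewrite !invW mxE mul0r.
Qed.

Lemma partial_warped_lshift (G : 'rV[R]_(n + s) -> R) (phi : 'rV[R]_n -> R) i :
  (forall y', U y' -> G (row_mx y' z) = phi y') ->
  partial (L i) G yz = partial i phi y.
Proof. by move=> GE; rewrite partial_lshift; apply: partial_eq_on GE. Qed.

Lemma partial_warped_rshift (G : 'rV[R]_(n + s) -> R) (psi : 'rV[R]_s -> R) i :
  (forall z', V z' -> G (row_mx y z') = psi z') ->
  partial (F i) G yz = partial i psi z.
Proof. by move=> GE; rewrite partial_rshift; apply: partial_eq_on GE. Qed.

Lemma derivable_grad k i : derivable (grad k) y (delta_mx 0 i).
Proof.
apply: derivable_bigsum => l; apply: derivable_mul.
  apply: (derivable_invmx oU Uy g_unit) => a c.
  exact: (smooth_derivable (g_smooth a c) Uy).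
exact: (smooth_partial_derivable f_smooth Uy).
Qed.

End AtPoint.

(** * Ricci tensor of a warped product *)

Section RicciAtPoint.
Variables (y : 'rV[R]_n) (z : 'rV[R]_s).
Hypotheses (Uy : U y) (Vz : V z).
Local Notation yz := (row_mx y z).
Local Notation Gam := (christoffel warped).

Let GamE := (christoffel_warpedL Uy Vz, christoffel_warpedFLL Uy Vz,
  christoffel_warpedLLF Uy Vz, christoffel_warpedLFL Uy Vz,
  christoffel_warpedFLF Uy Vz, christoffel_warpedFFL Uy Vz,
  christoffel_warpedLFF Uy Vz, christoffel_warpedF Uy Vz).

Lemma ricci_warped_split A C :
  ricci_vf warped (frame A) (frame C) yz =
  \sum_k (partial (L k) (Gam (L k) A C) yz
     + (\sum_j Gam (L k) (L k) (L j) yz * Gam (L j) A C yz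
        + \sum_j Gam (L k) (L k) (F j) yz * Gam (F j) A C yz)
     - (partial A (Gam (L k) (L k) C) yz
        + (\sum_j Gam (L k) A (L j) yz * Gam (L j) (L k) C yz
           + \sum_j Gam (L k) A (F j) yz * Gam (F j) (L k) C yz)))
  + \sum_k (partial (F k) (Gam (F k) A C) yz
     + (\sum_j Gam (F k) (F k) (L j) yz * Gam (L j) A C yz
        + \sum_j Gam (F k) (F k) (F j) yz * Gam (F j) A C yz)
     - (partial A (Gam (F k) (F k) C) yz
        + (\sum_j Gam (F k) A (L j) yz * Gam (L j) (F k) C yz
           + \sum_j Gam (F k) A (F j) yz * Gam (F j) (F k) C yz))).
Proof.
rewrite ricci_frame big_split_ord /=.
by congr (_ + _); apply: eq_bigr => k _; rewrite !big_split_ord.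
Qed.

(** Each fiber index [k] contributes the same [term] to the trace: the sum of
    the [Gamma^j_(a c) (d_j f) / f], minus the derivative of [(d_c f) / f], minus
    [(d_a f) (d_c f) / f^2].  This is minus the Hessian of [f] divided by [f],
    whence the factor [s]. *)
Lemma ricci_warpedLL a c :
  ricci_vf warped (frame (L a)) (frame (L c)) yz =
  ricci_vf g (frame a) (frame c) y
  - s%:R / f y * hessian_vf g f (frame a) (frame c) y.
Proof.
have f0 := f_neq0 Uy.
rewrite ricci_warped_split hessian_frame ricci_frame; congr (_ + _).
  apply: eq_bigr => k _.
  rewrite (partial_warped_lshift Uy (phi := christoffel g k a c)); last first.
    by move=> y' Uy'; rewrite christoffel_warpedL.
  rewrite (partial_warped_lshift Uy (phi := christoffel g k k c)); last first.
    by move=> y' Uy'; rewrite christoffel_warpedL.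
  congr (_ + _ - (_ + _)); rewrite [X in _ + X]big1 ?addr0 => [|j _].
  - by apply: eq_bigr => j _; rewrite !GamE.
  - by rewrite !GamE mul0r.
  - by apply: eq_bigr => j _; rewrite !GamE.
  - by rewrite !GamE mul0r.
pose term := (\sum_j partial j f y / f y * christoffel g j a c y)
  - partial a (partial c f) y / f y.
have termE k : partial (F k) (Gam (F k) (L a) (L c)) yz
     + (\sum_j Gam (F k) (F k) (L j) yz * Gam (L j) (L a) (L c) yz
        + \sum_j Gam (F k) (F k) (F j) yz * Gam (F j) (L a) (L c) yz)
     - (partial (L a) (Gam (F k) (F k) (L c)) yz
        + (\sum_j Gam (F k) (L a) (L j) yz * Gam (L j) (F k) (L c) yz
           + \sum_j Gam (F k) (L a) (F j) yz * Gam (F j) (F k) (L c) yz))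
     = term.
  rewrite (partial_warped_rshift Vz (psi := fun=> 0)); last first.
    by move=> z' Vz'; rewrite christoffel_warpedFLL.
  rewrite (partial_warped_lshift Uy (phi := fun y => partial c f y / f y));
    last first.
    by move=> y' Uy'; rewrite christoffel_warpedFFL // eqxx mul1r.
  rewrite partial_cst add0r [X in _ + X - _]big1 ?addr0 => [|j _]; last first.
    by rewrite !GamE mulr0.
  rewrite [X in _ - (_ + (X + _))]big1 ?add0r => [|j _]; last first.
    by rewrite !GamE mul0r.
  rewrite partial_div //; last 2 first.
  - exact: (smooth_partial_derivable f_smooth Uy).
  - exact: (smooth_derivable f_smooth Uy).
  under [X in X - _]eq_bigr => j _ do rewrite !GamE eqxx mul1r.
  under [X in _ - (_ + X)]eq_bigr => j _ do rewrite !GamE -mulrA.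
  rewrite sum_delta eqxx mul1r /term; congr (_ - _).
  by field.
under eq_bigr => k _ do rewrite termE.
rewrite sum_ord_const /term.
under eq_bigr => j _ do rewrite mulrAC.
rewrite -mulr_suml.
under eq_bigr => j _ do rewrite mulrC.
by field.
Qed.

Lemma partial_warped_lshift0 (G : 'rV[R]_(n + s) -> R) (r : R) i :
  (forall y', U y' -> G (row_mx y' z) = r) -> partial (L i) G yz = 0.
Proof.
by move=> GE; rewrite (partial_warped_lshift Uy (phi := fun=> r)) ?partial_cst.
Qed.

Lemma partial_warped_rshift0 (G : 'rV[R]_(n + s) -> R) (r : R) i :
  (forall z', V z' -> G (row_mx y z') = r) -> partial (F i) G yz = 0.
Proof.
by move=> GE; rewrite (partial_warped_rshift Vz (psi := fun=> r)) ?partial_cst.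
Qed.

(** The only nonzero contributions are two copies of
    [Gamma^k_(k c) (d_a f) / f], for [k] a fiber index, with opposite signs. *)
Lemma ricci_warpedLF a c :
  ricci_vf warped (frame (L a)) (frame (F c)) yz = 0.
Proof.
rewrite ricci_warped_split !big1 ?add0r // => k _.
  rewrite (partial_warped_rshift0
    (r := (k == c)%:R * (partial a f y / f y))); last first.
    by move=> z' Vz'; rewrite christoffel_warpedFLF.
  rewrite (partial_warped_lshift0 (r := christoffel h k k c z)); last first.
    by move=> y' Uy'; rewrite christoffel_warpedF.
  rewrite [X in _ + (X + _) - _]big1 => [|j _]; last by rewrite !GamE mulr0.
  rewrite [X in _ - (_ + (X + _))]big1 => [|j _]; last by rewrite !GamE mul0r.
  under [X in _ + (_ + X) - _]eq_bigr => j _ do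
    rewrite !GamE mulrCA [j == c]eq_sym.
  under [X in _ - (_ + (_ + X))]eq_bigr => j _ do rewrite !GamE -mulrA.
  by rewrite !sum_delta; ring.
rewrite !big1; first last.
- by move=> j _; rewrite !GamE mulr0.
- by move=> j _; rewrite !GamE mul0r.
- by move=> j _; rewrite !GamE mulr0.
- by move=> j _; rewrite !GamE mul0r.
rewrite (partial_warped_lshift0 (r := 0)); last first.
  by move=> y' Uy'; rewrite christoffel_warpedLLF.
rewrite (partial_warped_lshift0 (r := 0)); last first.
  by move=> y' Uy'; rewrite christoffel_warpedLLF.
by ring.
Qed.

(** As for [ricci_warpedLF], except that the two copies match only after
    exchanging the lower indices of a Christoffel symbol of [h]. *)
Lemma ricci_warpedFL a c :
  ricci_vf warped (frame (F c)) (frame (L a)) yz = 0.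
Proof.
rewrite ricci_warped_split !big1 ?add0r // => k _.
  rewrite (partial_warped_rshift0
    (r := (k == c)%:R * (partial a f y / f y))); last first.
    by move=> z' Vz'; rewrite christoffel_warpedFFL.
  rewrite (partial_warped_rshift0
    (r := (k == k)%:R * (partial a f y / f y))); last first.
    by move=> z' Vz'; rewrite christoffel_warpedFFL.
  rewrite [X in _ + (X + _) - _]big1 => [|j _]; last by rewrite !GamE mulr0.
  rewrite [X in _ - (_ + (X + _))]big1 => [|j _]; last by rewrite !GamE mulr0.
  under [X in _ + (_ + X) - _]eq_bigr => j _ do
    rewrite !GamE mulrCA [j == c]eq_sym.
  under [X in _ - (_ + (_ + X))]eq_bigr => j _ do
    rewrite !GamE mulrCA [j == k]eq_sym.
  rewrite !sum_delta (christoffel_sym k k c oV Vz h_sym).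
  by ring.
rewrite !big1; first last.
- by move=> j _; rewrite !GamE mulr0.
- by move=> j _; rewrite !GamE mul0r.
- by move=> j _; rewrite !GamE mul0r.
- by move=> j _; rewrite !GamE mulr0.
rewrite (partial_warped_lshift0 (r := 0)); last first.
  by move=> y' Uy'; rewrite christoffel_warpedLFL.
rewrite (partial_warped_rshift0 (r := christoffel g k k a y)); last first.
  by move=> z' Vz'; rewrite christoffel_warpedL.
by ring.
Qed.

(** A base index [k] contributes the [k]-th term of the divergence of
    [f grad f], less [(grad f)^k (d_k f)], times [- h_(a c)]; a fiber index
    contributes its term of the Ricci tensor of [h], minus [|grad f|^2 h_(a c)],
    which is compensated when [k = a].  Altogether [|grad f|^2] has coefficient
    [s - 2] in the defect. *)
Lemma ricci_warpedFF a c :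
  ricci_vf warped (frame (F a)) (frame (F c)) yz =
  ricci_vf h (frame a) (frame c) z - fiber_defect y * h z a c.
Proof.
have f0 := f_neq0 Uy.
set N := \sum_j grad j y * partial j f y.
pose D k := partial k (fun y => f y * grad k y) y
  + \sum_j christoffel g k k j y * (f y * grad j y).
have termL k : partial (L k) (Gam (L k) (F a) (F c)) yz
     + (\sum_j Gam (L k) (L k) (L j) yz * Gam (L j) (F a) (F c) yz
        + \sum_j Gam (L k) (L k) (F j) yz * Gam (F j) (F a) (F c) yz)
     - (partial (F a) (Gam (L k) (L k) (F c)) yz
        + (\sum_j Gam (L k) (F a) (L j) yz * Gam (L j) (L k) (F c) yz
           + \sum_j Gam (L k) (F a) (F j) yz * Gam (F j) (L k) (F c) yz))
     = - h z a c * (D k - grad k y * partial k f y).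
  rewrite (partial_warped_lshift Uy
    (phi := fun y => f y * grad k y * - h z a c)); last first.
    by move=> y' Uy'; rewrite christoffel_warpedLFF // mulNr mulrN.
  rewrite (partial_warped_rshift0 (r := 0)); last first.
    by move=> z' Vz'; rewrite christoffel_warpedLLF.
  rewrite partialMr; last first.
    apply: derivable_mul; first exact: (smooth_derivable f_smooth Uy).
    exact: derivable_grad.
  rewrite [X in _ + (_ + X) - _]big1 => [|j _]; last by rewrite !GamE mul0r.
  rewrite [X in _ - (_ + (X + _))]big1 => [|j _]; last by rewrite !GamE mul0r.
  under [X in _ + (X + _) - _]eq_bigr => j _ do rewrite !GamE mulNr mulrN mulrA.
  under [X in _ - (_ + (_ + X))]eq_bigr => j _ do
    rewrite !GamE mulrCA [j == c]eq_sym.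
  rewrite sum_delta sumrN -mulr_suml /D.
  by field.
(* stated on variables, so that ring does not compare sums up to conversion *)
have regroup (A B C E X Y : R) :
  A + (- X + B) - (C + (- Y + E)) = A + B - (C + E) - X + Y by ring.
have termF k : partial (F k) (Gam (F k) (F a) (F c)) yz
     + (\sum_j Gam (F k) (F k) (L j) yz * Gam (L j) (F a) (F c) yz
        + \sum_j Gam (F k) (F k) (F j) yz * Gam (F j) (F a) (F c) yz)
     - (partial (F a) (Gam (F k) (F k) (F c)) yz
        + (\sum_j Gam (F k) (F a) (L j) yz * Gam (L j) (F k) (F c) yz
           + \sum_j Gam (F k) (F a) (F j) yz * Gam (F j) (F k) (F c) yz))
     = (partial k (christoffel h k a c) z
          + \sum_j christoffel h k k j z * christoffel h j a c z
          - (partial a (christoffel h k k c) z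
             + \sum_j christoffel h k a j z * christoffel h j k c z))
       - N * h z a c + (a == k)%:R * (N * h z k c).
  rewrite (partial_warped_rshift Vz (psi := christoffel h k a c)); last first.
    by move=> z' Vz'; rewrite christoffel_warpedF.
  rewrite (partial_warped_rshift Vz (psi := christoffel h k k c)); last first.
    by move=> z' Vz'; rewrite christoffel_warpedF.
  have -> : \sum_j Gam (F k) (F k) (L j) yz * Gam (L j) (F a) (F c) yz
      = - (N * h z a c).
    rewrite mulr_suml -sumrN; apply: eq_bigr => j _.
    by rewrite !GamE eqxx mul1r; field.
  have -> : \sum_j Gam (F k) (F a) (L j) yz * Gam (L j) (F k) (F c) yz
      = - ((a == k)%:R * (N * h z k c)).
    rewrite mulr_suml mulr_sumr -sumrN; apply: eq_bigr => j _.
    by rewrite !GamE [k == a]eq_sym; field.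
  under [X in _ + (_ + X) - _]eq_bigr => j _ do rewrite !GamE.
  under [X in _ - (_ + (_ + X))]eq_bigr => j _ do rewrite !GamE.
  exact: regroup.
rewrite ricci_warped_split ricci_frame.
under eq_bigr => k _ do rewrite termL.
under [X in _ + X]eq_bigr => k _ do rewrite termF.
rewrite -mulr_sumr sumrB -/N [X in _ + X]big_split /= sumrB sum_delta.
rewrite sum_ord_const.
have collect (A B C M H : R) : - H * (A - M) + (B - C * (M * H) + M * H) =
  B - (A + (C - 2) * M) * H by ring.
exact: collect.
Qed.

Lemma ricci_warped :
  \matrix_(a, c) ricci_vf warped (frame a) (frame c) yz =
  block_mx
    (\matrix_(a, c) ricci_vf g (frame a) (frame c) y
       - (s%:R / f y) *: \matrix_(a, c) hessian_vf g f (frame a) (frame c) y) 0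
    0 (\matrix_(a, c) ricci_vf h (frame a) (frame c) z
         - fiber_defect y *: h z).
Proof.
apply/matrixP => a c; rewrite mxE.
case: (split_ordP a) => {}a ->; case: (split_ordP c) => {}c ->.
- by rewrite block_mxEul ricci_warpedLL !mxE.
- by rewrite block_mxEur ricci_warpedLF mxE.
- by rewrite block_mxEdl ricci_warpedFL mxE.
- by rewrite block_mxEdr ricci_warpedFF !mxE.
Qed.

End RicciAtPoint.
End WarpedChart.

(** * Traces with respect to a metric *)

Section MetricTrace.
Variable R : fieldType.

Lemma metric_trace_scale m (A : 'M[R]_m) (k : R) : A^T = A -> A \in unitmx ->
  \sum_a \sum_c invmx A a c * (k *: A) a c = m%:R * k.
Proof.
move=> At Au; rewrite -sum_ord_const; apply: eq_bigr => a _.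
under eq_bigr => c _ do rewrite mxE mulrCA.
by rewrite -mulr_sumr invmx_sum // eqxx mulr1.
Qed.

Lemma metric_trace_block m p (A : 'M[R]_m) (D : 'M[R]_p) (k l : R) :
  A^T = A -> A \in unitmx -> D^T = D -> D \in unitmx ->
  \sum_a \sum_c invmx (block_mx A 0 0 D) a c
     * block_mx (k *: A) 0 0 (l *: D) a c = m%:R * k + p%:R * l.
Proof.
move=> At Au Dt Du; rewrite invmx_block_diag; last first.
  by rewrite unitmxE det_ublock unitrM -!unitmxE Au.
rewrite big_split_ord -(metric_trace_scale k At Au).
rewrite -(metric_trace_scale l Dt Du) /=.
congr (_ + _); apply: eq_bigr => a _; rewrite big_split_ord /=.
  rewrite [X in _ + X]big1 ?addr0 => [|c _]; last first.
    by rewrite !block_mxEur !mxE mulr0.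
  by apply: eq_bigr => c _; rewrite !block_mxEul.
rewrite [X in X + _]big1 ?add0r => [|c _]; last first.
  by rewrite !block_mxEdl !mxE mulr0.
by apply: eq_bigr => c _; rewrite !block_mxEdr.
Qed.

End MetricTrace.

(** * Charts of a product manifold *)

Lemma chart_ran_nonempty (R : realType) n (M : topologicalType)
    (A : atlas R n M) :
  smooth_manifold A -> exists (i : chart_index A) x, chart_ran i x.
Proof.
by move=> [[_ _ [p _]] /(_ p)[i ip] _ _]; exists i, (chart i p), p.
Qed.

Lemma chart_ran_prod (R : realType) n s (B F : topologicalType)
    (AB : atlas R n B) (AF : atlas R s F) (ij : chart_index (prod_atlas AB AF))
    (x : 'rV[R]_(n + s)) :
  chart_ran ij x <-> chart_ran ij.1 (lsubmx x) /\ chart_ran ij.2 (rsubmx x).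
Proof.
split=> [[[p q] [/= dp dq] <-]|[[p dp px] [q dq qx]]].
  by rewrite row_mxKl row_mxKr; split; [exists p | exists q].
by exists (p, q); rewrite //= px qx hsubmxK.
Qed.

Lemma manifold_chart_metric (R : realType) n (M : topologicalType)
    (A : atlas R n M) (g : tensor2 A) (i : chart_index A) :
  semi_riemannian_manifold g -> chart_metric (chart_ran i) (g i).
Proof.
move=> [[_ _ /(_ i)[_ oi _ _ _] _] [gs _ gsu _]]; split=> //.
- by move=> x /gsu[].
- by move=> x /gsu[].
Qed.

(** * Einstein warped products *)

Section WarpedManifold.
Variables (R : realType) (n s : nat) (B F : topologicalType).
Variables (AB : atlas R n B) (AF : atlas R s F).
Variables (gB : tensor2 AB) (gF : tensor2 AF) (b : B -> R).
Hypotheses (hB : semi_riemannian_manifold gB).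
Hypotheses (hF : semi_riemannian_manifold gF).
Hypotheses (b_smooth : smooth_function AB b) (b_gt0 : forall p, 0 < b p).

Local Notation W := (warped_metric gB gF b).
Local Notation bc i := (b \o @chart_inv _ _ _ AB i).

Lemma warping_neq0 i y : bc i y != 0 :> R.
Proof. by apply: lt0r_neq0; apply: b_gt0. Qed.

Lemma warped_metricE (i : chart_index AB) (j : chart_index AF) y z :
  W (i, j) (row_mx y z) = block_mx (gB i y) 0 0 (bc i y ^+ 2 *: gF j z).
Proof. exact: warpedE. Qed.

Lemma ricci_warped_metric (i : chart_index AB) (j : chart_index AF) y z :
  chart_ran i y -> chart_ran j z ->
  ricci W (i, j) (row_mx y z) =
  block_mx (ricci gB i y - (s%:R / bc i y) *: hessian gB b i y) 0
           0 (ricci gF j z - fiber_defect s (gB i) (bc i) y *: gF j z).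
Proof.
move=> iy jz; apply: ricci_warped iy jz => //.
- exact: manifold_chart_metric.
- exact: manifold_chart_metric.
- by move=> x _; apply: warping_neq0.
Qed.

Lemma warped_metric_sym ij x : chart_ran ij x -> (W ij x)^T = W ij x.
Proof.
case: ij => i j /chart_ran_prod[/= iy jz]; rewrite -[x]hsubmxK.
exact: (@warped_sym _ _ _ _ _ _ _ (bc i) (manifold_chart_metric i hB)
  (manifold_chart_metric j hF) _ _ iy jz).
Qed.

Lemma warped_metric_unit ij x : chart_ran ij x -> W ij x \in unitmx.
Proof.
case: ij => i j /chart_ran_prod[/= iy jz]; rewrite -[x]hsubmxK.
apply: (@warped_unit _ _ _ _ _ _ _ (bc i) (manifold_chart_metric i hB)
  (manifold_chart_metric j hF) _ _ _ iy jz) => y _.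
exact: warping_neq0.
Qed.

Lemma scalar_curvature_einstein lambda :
  einstein_with W lambda -> has_scalar_curvature W ((n + s)%:R * lambda).
Proof.
move=> Elambda ij x ijx; rewrite /scalar_curvature (Elambda ij x ijx).
rewrite metric_trace_scale //.
- exact: warped_metric_sym.
- exact: warped_metric_unit.
Qed.

Definition base_equation (lambda : R) : Prop :=
  tensor_eq (ricci gB) (fun i x =>
    lambda *: gB i x + (s%:R / b (chart_inv i x)) *: hessian gB b i x).

(** The two blocks of [Ric = lambda W] are the two equations.  The first one does
    not involve the fiber, but it is read off in a product chart, hence at some
    chosen point [z0] of the fiber. *)
Lemma einstein_warpedP lambda :
  einstein_with W lambda <->
  base_equation lambda /\
  forall i j y z, chart_ran i y -> chart_ran j z ->
    ricci gF j z =
    (lambda * bc i y ^+ 2 + fiber_defect s (gB i) (bc i) y) *: gF j z.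
Proof.
have [j0 [z0 jz0]] := chart_ran_nonempty hF.1.
have [i0 [y0 iy0]] := chart_ran_nonempty hB.1.
have block i j y z (iy : chart_ran i y) (jz : chart_ran j z) :
    ricci W (i, j) (row_mx y z) = lambda *: W (i, j) (row_mx y z) <->
    ricci gB i y = lambda *: gB i y + (s%:R / bc i y) *: hessian gB b i y /\
    ricci gF j z =
    (lambda * bc i y ^+ 2 + fiber_defect s (gB i) (bc i) y) *: gF j z.
  rewrite ricci_warped_metric // warped_metricE scale_block_mx !scaler0.
  rewrite scalerDl -[(lambda * _) *: _]scalerA; split.
    move=> /eq_block_mx[/eqP EB _ _ /eqP EF].
    by rewrite !subr_eq in EB EF; split; apply/eqP.
  by move=> [-> ->]; rewrite !addrK.
split=> [E|[EB EF] [i j] x /chart_ran_prod[/= iy jz]].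
  split=> [i y iy|i j y z iy jz].
    have [+ _] := block i j0 y z0 iy jz0; case=> //; apply: E.
    by apply/chart_ran_prod; rewrite row_mxKl row_mxKr.
  have [+ _] := block i j y z iy jz; case=> //; apply: E.
  by apply/chart_ran_prod; rewrite row_mxKl row_mxKr.
by rewrite -[x]hsubmxK; apply/block => //; split; [apply: EB | apply: EF].
Qed.

(** For the converse, the trace of the Ricci tensor is compared with
    [(n + s) lambda]: the base block accounts for [n lambda], so the ratio of the
    fiber block to the metric is [lambda] as soon as there is a fiber index. *)
Lemma einstein_warped_scalarP lambda :
  einstein_with W lambda <->
  [/\ base_equation lambda, exists mu, einstein_with gF mu &
      has_scalar_curvature W ((n + s)%:R * lambda)].
Proof.
split=> [E|[EB [mu Emu] scal]].
  have [EB EF] := (einstein_warpedP lambda).1 E.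
  split=> //; last exact: scalar_curvature_einstein.
  have [i [y iy]] := chart_ran_nonempty hB.1.
  exists (lambda * bc i y ^+ 2 + fiber_defect s (gB i) (bc i) y) => j z.
  exact: EF.
apply/einstein_warpedP; split=> // i j y z iy jz; rewrite Emu //.
set d := fiber_defect _ _ _ _.
apply/matrixP => a c; rewrite !mxE; congr (_ * _).
(* the fiber index a shows that s is positive *)
have s_neq0 : s%:R != 0 :> R.
  by rewrite pnatr_eq0 -lt0n (leq_ltn_trans (leq0n a)) ?ltn_ord.
have b2_neq0 : bc i y ^+ 2 != 0 by rewrite expf_neq0 // warping_neq0.
have ijyz : @chart_ran _ _ _ (prod_atlas AB AF) (i, j) (row_mx y z).
  by apply/chart_ran_prod; rewrite row_mxKl row_mxKr.
have := scal (i, j) (row_mx y z) ijyz.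
rewrite /scalar_curvature ricci_warped_metric // warped_metricE EB // addrK.
rewrite Emu // -scalerBl.
have -> : (mu - d) *: gF j z =
    (mu - d) / bc i y ^+ 2 *: (bc i y ^+ 2 *: gF j z).
  by rewrite scalerA divfK.
rewrite metric_trace_block; first last.
- rewrite unitmxZ ?unitfE //.
  by case: (manifold_chart_metric j hF) => _ _ _; apply.
- by rewrite linearZ; case: (manifold_chart_metric j hF) => _ _ /(_ z jz) /= ->.
- by case: (manifold_chart_metric i hB) => _ _ _; apply.
- by case: (manifold_chart_metric i hB) => _ _ ->.
rewrite natrD [(_ + _) * lambda]mulrDl => /addrI /(mulfI s_neq0) <-.
by rewrite divfK // subrK.
Qed.

(** Taking the trace at one point, [tau = (n + s) lambda], so that
    [tau / (n + s)] is the only candidate for the Einstein constant. *)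
Lemma einstein_scalar_constP tau :
  has_scalar_curvature W tau -> einstein gF ->
  einstein W <-> base_equation (tau / (n + s)%:R).
Proof.
move=> scal EF.
have [j [z jz]] := chart_ran_nonempty hF.1.
have [i [y iy]] := chart_ran_nonempty hB.1.
have ijyz : @chart_ran _ _ _ (prod_atlas AB AF) (i, j) (row_mx y z).
  by apply/chart_ran_prod; rewrite row_mxKl row_mxKr.
split=> [[lambda E]|EB].
  have [EB _] := (einstein_warpedP lambda).1 E.
  move=> k x kx; apply/matrixP => a c.
  have ns_neq0 : (n + s)%:R != 0 :> R.
    by rewrite pnatr_eq0 -lt0n addn_gt0 (leq_ltn_trans (leq0n a)) ?ltn_ord.
  have <- : (n + s)%:R * lambda = tau.
    by rewrite -(scal _ _ ijyz) -(scalar_curvature_einstein E ijyz).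
  by rewrite mulrAC divff // mul1r EB.
exists (tau / (n + s)%:R); apply/einstein_warped_scalarP; split=> //.
suff -> : (n + s)%:R * (tau / (n + s)%:R) = tau by [].
have [ns0|ns_neq0] := eqVneq ((n + s)%:R : R) 0; last by rewrite mulrC divfK.
(* in dimension 0 the scalar curvature is an empty sum, so tau = 0 *)
rewrite ns0 mul0r -(scal _ _ ijyz) /scalar_curvature big1 // => a _.
have := leq_ltn_trans (leq0n a) (ltn_ord a).
by rewrite lt0n -(pnatr_eq0 R) ns0 eqxx.
Qed.

End WarpedManifold.

Theorem corollary4p3 (R : realType) (n s1 : nat) (B F1 : topologicalType)
    (AB : atlas R n B) (AF1 : atlas R s1 F1)
    (gB : tensor2 AB) (gF1 : tensor2 AF1) (b1 : B -> R)
    (hB : semi_riemannian_manifold gB) (hF1 : semi_riemannian_manifold gF1)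
    (b1_smooth : smooth_function AB b1) (b1_gt0 : forall p : B, 0 < b1 p) :
  (forall lambda : R,
     einstein_with (warped_metric gB gF1 b1) lambda <->
     [/\ tensor_eq (ricci gB) (fun i x =>
           lambda *: gB i x +
           (s1%:R / b1 (chart_inv i x)) *: hessian gB b1 i x),
         exists mu1 : R, einstein_with gF1 mu1 &
         has_scalar_curvature (warped_metric gB gF1 b1)
           ((n + s1)%:R * lambda)])
  /\
  (forall tau : R,
     has_scalar_curvature (warped_metric gB gF1 b1) tau ->
     einstein gF1 ->
     (einstein (warped_metric gB gF1 b1) <->
      tensor_eq (ricci gB) (fun i x =>
        (tau / (n + s1)%:R) *: gB i x +
        (s1%:R / b1 (chart_inv i x)) *: hessian gB b1 i x))).
Proof.
split=> [lambda|tau scal EF1].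
  exact: einstein_warped_scalarP.
exact: einstein_scalar_constP.
Qed.
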